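(* Let $U\subseteq[1,n]$ be a set of size $m$, and let $S\in\{0,1\}^n$ be the bit-string representing $U$, i.e. $S[i]=1$ iff $i\in U$. Let $g$ be the size of a Straight-Line Program for $S$. Then $\Omega(\log n/\log\log n)$ time is needed to perform predecessor queries on $U$ with any static data structure using $O(g\,\mathrm{polylog}\,n)$ space.
   Context: A Straight-Line Program (SLP) is a context-free grammar generating exactly one string, with rules of the form $X\to AB$ ($A,B$ terminals or nonterminals); its size is the number of nonterminals. A predecessor query on $U$ with argument $y$ returns the largest $x\in U$ with $x\le y$. Space is measured in machine words of $O(\log n)$ bits; the lower bound is for static data structures. *)

(* Defs.v *)
From mathcomp Require Import all_boot all_order all_algebra.
From mathcomp Require Import reals exp.

Set Implicit Arguments.
Unset Strict Implicit.
Unset Printing Implicit Defensive.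

(* Context-free grammars over {0,1} whose rules all have the form X -> A B.
   A symbol [inl b] is the terminal b, a symbol [inr X] is a nonterminal.
   The triple (X, (A, B)) stands for the rule X -> A B; a priori a nonterminal
   may have any number of rules. *)
Definition symbol (g : nat) : finType := (bool + 'I_g)%type.

Record grammar := Grammar {
  gsize : nat;
  gstart : 'I_gsize;
  grules : {set 'I_gsize * (symbol gsize * symbol gsize)} }.

Inductive derives (G : grammar) : symbol (gsize G) -> seq bool -> Prop :=
| derives_terminal (b : bool) : derives (G := G) (inl b) [:: b]
| derives_rule (X : 'I_(gsize G)) (A B : symbol (gsize G)) (u v : seq bool) :
    (X, (A, B)) \in grules G -> derives A u -> derives B v ->
    derives (inr X) (u ++ v).

Definition slp_for (G : grammar) (s : seq bool) : Prop :=
  forall u : seq bool, @derives G (inr (gstart G)) u <-> u = s.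

(* Subsets of [1, n] are the U : {set 'I_n.+1} that do not contain 0. *)
Definition in_universe (n : nat) (U : {set 'I_n.+1}) : Prop := ord0 \notin U.

Definition bitstring (n : nat) (U : {set 'I_n.+1}) : seq bool :=
  [seq inord i \in U | i <- iota 1 n].

Definition is_predecessor (n : nat) (U : {set 'I_n.+1}) (y x : 'I_n.+1) : Prop :=
  [/\ x \in U, x <= y & forall z : 'I_n.+1, z \in U -> z <= y -> z <= x].

(* Adaptive query algorithms in the cell-probe model: the memory is read one
   w-bit cell at a time, each address may depend on everything read so far,
   and only the probes are charged. *)
Definition word (w : nat) : Type := w.-tuple bool.

Inductive probe_tree (w : nat) (A : Type) : Type :=
| Return (a : A)
| Probe (addr : nat) (next : word w -> probe_tree w A).

Arguments Return {w A}.
Arguments Probe {w A}.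

(* Cells beyond the end of the memory read as zero. *)
Definition read_cell (w : nat) (M : seq (word w)) (addr : nat) : word w :=
  nth [tuple of nseq w false] M addr.

Fixpoint answer (w : nat) (A : Type) (M : seq (word w)) (t : probe_tree w A) : A :=
  match t with
  | Return a => a
  | Probe addr next => answer M (next (read_cell M addr))
  end.

Fixpoint probes (w : nat) (A : Type) (M : seq (word w)) (t : probe_tree w A) : nat :=
  match t with
  | Return _ => 0
  | Probe addr next => (probes M (next (read_cell M addr))).+1
  end.

(* A static structure on [1, n]: the preprocessing is an arbitrary function of
   the set and of the grammar given for its bit-string; the query algorithm
   knows n, w and y, and learns about the set only through its probes. *)
Record static_structure (n w : nat) := StaticStructure {
  memory : {set 'I_n.+1} -> grammar -> seq (word w);
  query : 'I_n.+1 -> probe_tree w 'I_n.+1 }.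

(* A query without predecessor may be answered arbitrarily. *)
Definition answers_predecessor (n w : nat) (D : static_structure n w) : Prop :=
  forall (U : {set 'I_n.+1}) (G : grammar) (y x : 'I_n.+1),
    in_universe U -> slp_for G (bitstring U) -> is_predecessor U y x ->
    answer (memory D U G) (query D y) = x.

Definition uses_space (n w : nat) (D : static_structure n w)
    (R : realType) (bound : grammar -> R) : Prop :=
  forall (U : {set 'I_n.+1}) (G : grammar),
    in_universe U -> slp_for G (bitstring U) ->
    ((size (memory D U G))%:R <= bound G)%R.

(* Main.v *)
(** Tables of bits [T : [N] x [B] -> {0,1}] are encoded by the string whose entry
    at the index with base-[B] digits [q_0, ..., q_(N-1)] is the XOR of the bits
    [T(j, q_j)]. It has an SLP of size about [2 N B]: one nonterminal per level,
    per choice of complementing the string or not, and per block. With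
    [B = polylog n] and [B^N = n^(1-o(1))], the SLP and hence the memory have polylog size,
    so a probe reveals only [O(log log n)] bits of the query. After
    [t = o(log n / log log n)] probes, round elimination leaves a rectangle of
    [n^(1-o(1))] queries and a [2^(-t w)] fraction of the tables on which every
    answer is constant. Those queries take more than [t w] values in some digit
    [i], so they pin down more than [t w] bits of row [i], a contradiction. *)

Require Import Defs.
From mathcomp Require Import all_boot all_order all_algebra.
From mathcomp Require Import reals exp.
From mathcomp Require Import zify lra.

Set Implicit Arguments.
Unset Strict Implicit.
Unset Printing Implicit Defensive.

Import Order.TTheory GRing.Theory Num.Theory.
Local Open Scope ring_scope.

(** * Straight-line programs as chains of strings *)

(** One-letter strings are terminals, so they cost no nonterminal. *)
Definition avail (l : seq (seq bool)) (u : seq bool) : bool :=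
  (size u == 1%N) || (u \in l).

(* Strings produced by a straight-line program, the most recent one first. *)
Inductive chain : seq (seq bool) -> Prop :=
| chain_nil : chain [::]
| chain_cons u v l :
    chain l -> avail l u -> avail l v -> chain ((u ++ v) :: l).

Lemma avail_cat l' l u : avail l u -> avail (l' ++ l) u.
Proof. by rewrite /avail mem_cat => /orP[-> //|->]; rewrite !orbT. Qed.

Lemma chain_nth l i : chain l -> (i < size l)%N ->
  exists u v, [/\ nth [::] l i = u ++ v, avail (drop i.+1 l) u
                & avail (drop i.+1 l) v].
Proof.
move=> cl; elim: cl i => // u v l' _ IH au av [_|i /=]; last exact: IH.
by exists u, v; rewrite drop1.
Qed.

Definition symbol_value (l : seq (seq bool)) (x : symbol (size l)) : seq bool :=
  match x with inl b => [:: b] | inr i => nth [::] l i end.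

Lemma avail_symbol l (i : nat) u : avail (drop i.+1 l) u ->
  exists A : symbol (size l), symbol_value A = u /\
    forall j, A = inr j -> (i < j)%N.
Proof.
case/orP=> [|/(nthP [::]) [j]].
  by case: u => [|b []] //= _; exists (inl b).
rewrite size_drop nth_drop => ltj <-.
have lt : (i.+1 + j < size l)%N by rewrite -ltn_subRL.
exists (inr (Ordinal lt)); split=> // j' [<-] /=.
by rewrite addSn ltnS leq_addr.
Qed.

(** Each position of the chain becomes a nonterminal with a single rule, which refers only to older
    strings, that is, to larger positions. The grammar is therefore acyclic and deterministic. *)
Lemma chain_slp l s : chain l -> s \in l ->
  exists2 G : grammar, gsize G = size l & slp_for G s.
Proof.
move=> cl sl.
have ltS : (index s l < size l)%N by rewrite index_mem.
have /fin_all_exists [r rP] (i : 'I_(size l)) :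
    exists AB : symbol (size l) * symbol (size l),
    [/\ nth [::] l i = symbol_value AB.1 ++ symbol_value AB.2,
        forall j, AB.1 = inr j -> (i < j)%N & forall j, AB.2 = inr j -> (i < j)%N].
  have [u [v [-> /avail_symbol [A [<- HA]] /avail_symbol [B [<- HB]]]]] :=
    chain_nth cl (ltn_ord i).
  by exists (A, B).
pose G := @Grammar (size l) (Ordinal ltS) [set (i, r i) | i : 'I_(size l)].
have sound (x : symbol (gsize G)) u : @derives G x u -> u = @symbol_value l x.
  elim=> // X A B u' v' /imsetP [i _ [-> rE]] _ -> _ ->.
  by have [/= -> _ _] := rP i; rewrite -rE.
(* The induction bounds the distance to the end of [l], which decreases along every rule. *)
have complete m (i : 'I_(size l)) : (size l - i <= m)%N ->
    @derives G (inr i) (nth [::] l i).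
  elim: m i => [|m IH] i; first by rewrite leqNgt subn_gt0 ltn_ord.
  move=> lem; have [-> lt1 lt2] := rP i.
  have der (A : symbol (size l)) :
      (forall j, A = inr j -> (i < j)%N) -> @derives G A (symbol_value A).
    case: A => [b|j] ltj; first exact: (derives_terminal G b).
    by apply: IH; have := ltj j erefl; lia.
  apply: (@derives_rule G i (r i).1 (r i).2); [|exact: der..].
  by apply/imsetP; exists i => //; case: (r i).
exists G => // u; split=> [/sound ->|->] /=; first exact: nth_index.
by rewrite -{2}(nth_index [::] sl); apply: (complete _ (Ordinal ltS)) (leqnn _).
Qed.

Lemma chain_flatten l ss : chain l -> ss != [::] -> all (avail l) ss ->
  exists l', [/\ chain (l' ++ l), (size l' <= size ss)%N
               & avail (l' ++ l) (flatten ss)].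
Proof.
move=> cl; elim: ss => // s [|s' ss] IH _ /andP[as_ ass].
  by exists [::]; rewrite /= cats0.
have [//|//|l' [cl' sz av]] := IH.
exists ((s ++ flatten (s' :: ss)) :: l'); split=> //.
  by rewrite cat_cons; apply: chain_cons => //; apply: avail_cat.
by rewrite /avail cat_cons mem_head orbT.
Qed.

(** Repeated halving: [z] zeros are two copies of [z./2] zeros and at most one further letter, so
    each binary digit of [z] costs at most three strings. *)
Lemma chain_zeros l e z : chain l -> (0 < z < 2 ^ e)%N ->
  exists l', [/\ chain (l' ++ l), (size l' <= 3 * e)%N
               & avail (l' ++ l) (nseq z false)].
Proof.
move=> cl; elim: e z => [|e IH] z; first by case: z.
case: (ltnP 1 z) => [z1 /andP[_ zlt]|]; last by case: z => [|[]] // _ _; exists [::].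
have [|l1 [c1 s1 a1]] := IH z./2.
  by rewrite half_gt0 z1 ltn_half_double -mul2n -expnS.
pose h := nseq z./2 false; pose ss := [:: h, h & nseq (odd z) [:: false]].
have ass : all (avail (l1 ++ l)) ss by rewrite /= a1 /=; case: (odd z).
have [//|l2 [c2 s2 a2]] := chain_flatten c1 _ ass.
exists (l2 ++ l1); rewrite -catA; split=> //.
  by rewrite size_cat mulnS leq_add // (leq_trans s2) //=; case: (odd z).
suff <- : flatten ss = nseq z false by [].
rewrite /ss /= -[RHS]/(nseq z false) -{2}(odd_double_half z) -addnn addnC !nseqD /h.
by rewrite -catA; congr (_ ++ (_ ++ _)); case: (odd z).
Qed.

(** * The XOR string and its compression *)

(** The bit [b] accumulates the parity of the entries selected by the more significant digits; digit
    [i] selects a block at level [i.+1]. *)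
Fixpoint xor_string (B : nat) (T : nat -> nat -> bool) (j : nat) (b : bool) :=
  if j is i.+1 then flatten [seq xor_string B T i (b (+) T i c) | c <- iota 0 B]
  else [:: b].

Lemma size_flatten_const (T : Type) (m : nat) (ss : seq (seq T)) :
  all (fun s => size s == m) ss -> size (flatten ss) = (size ss * m)%N.
Proof. by elim: ss => //= s ss IH /andP[/eqP sm /IH]; rewrite size_cat sm mulSn => ->. Qed.

Lemma nth_flatten_const (T : Type) (x0 : T) (m i r : nat) (ss : seq (seq T)) :
  all (fun s => size s == m) ss -> (r < m)%N ->
  nth x0 (flatten ss) (r + i * m) = nth x0 (nth [::] ss i) r.
Proof.
elim: ss i => [|s ss IH] i /=; first by rewrite !nth_nil.
move=> /andP[/eqP sm all_m] rm; rewrite nth_cat sm.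
case: i => [|i]; first by rewrite addn0 rm.
by rewrite mulSn addnCA ltnNge leq_addr /= addKn IH.
Qed.

Lemma size_xor_string B T j b : size (xor_string B T j b) = (B ^ j)%N.
Proof.
elim: j b => // j IH b /=.
rewrite (@size_flatten_const _ (B ^ j)) ?size_map ?size_iota ?expnS //.
by apply/allP=> _ /mapP[c _ ->]; rewrite IH.
Qed.

Lemma nth_xor_string B T j b (q : nat -> nat) :
  (forall i, (i < j)%N -> (q i < B)%N) ->
  (\sum_(i < j) q i * B ^ i < B ^ j)%N /\
  nth false (xor_string B T j b) (\sum_(i < j) q i * B ^ i)%N =
    b (+) \big[addb/false]_(i < j) T i (q i).
Proof.
elim: j b => [|j IH] b qB; first by rewrite !big_ord0 addbF.
have qB' i : (i < j)%N -> (q i < B)%N by move=> ij; apply: qB; apply: ltnW.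
have [lt _] := IH b qB'; have qj := qB j (leqnn _).
rewrite !big_ord_recr /=; split.
  rewrite expnS; apply: (@leq_trans ((q j).+1 * B ^ j)); last by rewrite leq_mul2r qj orbT.
  by rewrite mulSn ltn_add2r.
rewrite nth_flatten_const //; last first.
  by apply/allP=> _ /mapP[c _ ->]; rewrite size_xor_string.
rewrite (nth_map 0%N) ?size_iota // nth_iota //.
have [_ ->] := IH (b (+) T j (q j)) qB'.
by rewrite -addbA [X in b (+) X]addbC.
Qed.

(** All blocks of a level are among the two strings of the level below, so each of the two new
    strings costs at most [B] concatenations. *)
Lemma chain_xor_string B T j : (0 < B)%N ->
  exists l, [/\ chain l, (size l <= 2 * (j * B))%N
              & forall b, avail l (xor_string B T j b)].
Proof.
move=> B0; elim: j => [|j [l [cl sl al]]].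
  by exists [::]; split=> //; exact: chain_nil.
pose ss b := [seq xor_string B T j (b (+) T j c) | c <- iota 0 B].
have ss0 b : ss b != [::] by rewrite -size_eq0 size_map size_iota -lt0n.
have ass b : all (avail l) (ss b) by apply/allP=> _ /mapP[c _ ->].
have [l1 [c1 s1 a1]] := chain_flatten cl (ss0 true) (ass true).
have ass' : all (avail (l1 ++ l)) (ss false).
  by apply/allP=> s /(allP (ass false)) /avail_cat ->.
have [l2 [c2 s2 a2]] := chain_flatten c1 (ss0 false) ass'.
exists (l2 ++ l1 ++ l); split=> //; last by case=> //; apply: avail_cat.
by move: s1 s2; rewrite !size_cat !size_map !size_iota; lia.
Qed.

(* The leading [true] puts 1 into the set, so that every query has a predecessor. *)
Definition padded_xor_string (B N n : nat) (T : nat -> nat -> bool) : seq bool :=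
  true :: xor_string B T N false ++ nseq (n - (B ^ N).+1) false.

Lemma size_padded_xor_string B N n T : ((B ^ N).+1 <= n)%N ->
  size (padded_xor_string B N n T) = n.
Proof. by rewrite /= size_cat size_xor_string size_nseq -addSn => /subnKC. Qed.

(** The strict bound on [B ^ N] keeps the block of zeros nonempty: no grammar of this form derives
    the empty string. *)
Lemma padded_xor_string_slp B N n e T :
  (0 < B)%N -> ((B ^ N).+1 < n)%N -> (n < 2 ^ e)%N ->
  exists2 G : grammar, (gsize G <= 2 * (N * B) + 3 * e + 3)%N
    & slp_for G (padded_xor_string B N n T).
Proof.
move=> B0 BNn ne; have [l [cl sl al]] := chain_xor_string T N B0.
have [|l1 [c1 s1 a1]] := @chain_zeros l e (n - (B ^ N).+1) cl.
  by rewrite subn_gt0 BNn (leq_ltn_trans (leq_subr _ _)).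
pose ss := [:: [:: true]; xor_string B T N false; nseq (n - (B ^ N).+1) false].
have ass : all (avail (l1 ++ l)) ss by rewrite /= a1 avail_cat.
have [//|l2 [c2 s2 a2]] := chain_flatten c1 _ ass.
have ssE : flatten ss = padded_xor_string B N n T by rewrite /= cats0.
have [|G sG GP] := @chain_slp _ (padded_xor_string B N n T) c2; last first.
  by exists G; rewrite // sG !size_cat; move: s2 => /=; lia.
move: a2; rewrite ssE /avail size_padded_xor_string; last exact: ltnW.
by case: eqP => // n1; move: BNn; rewrite n1 ltnS ltn0.
Qed.

(** * From strings to sets and predecessors *)

(** Elements count from 1 and string positions from 0. The guard excludes 0, whose truncated [i.-1]
    would read the first letter. *)
Definition set_of_string (n : nat) (s : seq bool) : {set 'I_n.+1} :=
  [set i : 'I_n.+1 | (0 < i)%N && nth false s i.-1].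

Lemma in_universe_set_of_string n s : in_universe (set_of_string n s).
Proof. by rewrite /in_universe inE. Qed.

Lemma bitstring_set_of_string n s : size s = n ->
  bitstring (set_of_string n s) = s.
Proof.
move=> sn; apply: (@eq_from_nth _ false); rewrite size_map size_iota ?sn // => i ilt.
rewrite (nth_map 0%N) ?size_iota // nth_iota // inE inordK ?ltnS //.
Qed.

Lemma predecessor_exists n (U : {set 'I_n.+1}) (y z : 'I_n.+1) :
  z \in U -> (z <= y)%N -> exists x, is_predecessor U y x.
Proof.
move=> zU zy.
have zP : (z \in U) && (z <= y)%N by rewrite zU.
case: (@arg_maxnP _ z [pred i | (i \in U) && (i <= y)%N] val zP) => x /andP[xU xy] xmax.
by exists x; split=> // z' z'U z'y; apply/xmax/andP.
Qed.

(** This turns a predecessor answer into a membership bit, hence into a letter of the string. *)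
Lemma predecessor_self n (U : {set 'I_n.+1}) (y x : 'I_n.+1) :
  is_predecessor U y x -> (x == y) = (y \in U).
Proof.
case=> xU xy xmax; apply/eqP/idP => [<- //|yU].
by apply/val_inj/anti_leq; rewrite xy xmax.
Qed.

(** * Round elimination *)

Lemma pigeonhole (I J : finType) (A : {set I}) (f : I -> J) : (0 < #|J|)%N ->
  exists j, (#|A| <= #|[set i in A | f i == j]| * #|J|)%N.
Proof.
move=> /card_gt0P [j0 _].
have [j _ jmax] := @arg_maxnP _ j0 predT (fun j => #|[set i in A | f i == j]|) isT.
exists j; rewrite -sum1_card (partition_big f predT) //= mulnC -sum_nat_const.
apply: leq_sum => j' _; apply: leq_trans (jmax j' isT).
by rewrite -sum1_card; apply: eq_leq; apply: eq_bigl => i; rewrite inE.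
Qed.

(** Addresses are unbounded, but all those beyond the memory read the same zero word. Clamping
    leaves [S.+1] addresses for the pigeonhole. *)
Lemma read_cell_minn w (M : seq (word w)) S a : (size M <= S)%N ->
  read_cell M (minn a S) = read_cell M a.
Proof.
move=> MS; case: leqP => // Sa.
by rewrite /read_cell !nth_default // (leq_trans MS) // ltnW.
Qed.

(* Deterministic round elimination: each round keeps the queries that probe the
   most popular address, then the memories with the most popular content
   there. *)
Lemma probe_rectangle (w S t : nat) (Q F : finType) (X : Type)
    (M : F -> seq (word w)) (p : Q -> probe_tree w X) (A : {set Q}) (E : {set F}) :
  (forall x, (size (M x) <= S)%N) ->
  (forall q x, q \in A -> x \in E -> (probes (M x) (p q) <= t)%N) ->
  exists (A' : {set Q}) (E' : {set F}),
    [/\ A' \subset A, E' \subset E, (#|A| <= #|A'| * S.+1 ^ t)%N,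
        (#|E| <= #|E'| * 2 ^ (w * t))%N
      & forall q x x', q \in A' -> x \in E' -> x' \in E' ->
          answer (M x) (p q) = answer (M x') (p q)].
Proof.
move=> MS; elim: t p A E => [|t IH] p A E pt.
  exists A, E; rewrite !muln1 muln0 muln1; split=> // q x x' qA xE x'E.
  by have := pt q x qA xE; case: (p q).
(* Queries that have already returned get the dummy address 0, and [p'] leaves them unchanged. *)
pose addr q : 'I_S.+1 := inord (if p q is Probe a _ then minn a S else 0).
have [|a Aa] := @pigeonhole _ _ A addr; first by rewrite card_ord.
have [|v Ev] := @pigeonhole _ _ E (fun x => read_cell (M x) a).
  by rewrite card_tuple card_bool expn_gt0.
set A1 := [set q in A | _] in Aa; set E1 := [set x in E | _] in Ev.
pose p' q := if p q is Probe _ next then next v else p q.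
have p'P q x : q \in A1 -> x \in E1 ->
    answer (M x) (p q) = answer (M x) (p' q) /\ (probes (M x) (p' q) <= t)%N.
  rewrite !inE => /andP[qA qa] /andP[xE /eqP xv].
  have := pt q x qA xE; move: qa; rewrite /addr /p'.
  case: (p q) => //= b next /eqP ba; suff -> : read_cell (M x) b = v by [].
  by rewrite -(read_cell_minn b (MS x)) -xv -ba inordK // ltnS geq_minr.
have [|A' [E' [A'A1 E'E1 cA cE const]]] := IH p' A1 E1.
  by move=> q x qA xE; have [] := p'P q x qA xE.
exists A', E'; split.
- by apply: subset_trans A'A1 _; apply/subsetP=> q; rewrite inE => /andP[].
- by apply: subset_trans E'E1 _; apply/subsetP=> q; rewrite inE => /andP[].
- by rewrite expnSr mulnA (leq_trans Aa) // card_ord leq_mul2r cA orbT.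
- rewrite mulnS addnC expnD mulnA (leq_trans Ev) // card_tuple card_bool.
  by rewrite leq_mul2r cE orbT.
move=> q x x' qA' xE' x'E'.
have qA1 := subsetP A'A1 q qA'.
have [-> _] := p'P q x qA1 (subsetP E'E1 x xE').
have [-> _] := p'P q x' qA1 (subsetP E'E1 x' x'E').
exact: const.
Qed.

(** * Counting tables on which many queries are constant *)

Definition xor_query (N B : nat) (T : {set 'I_N * 'I_B}) (q : {ffun 'I_N -> 'I_B}) :=
  \big[addb/false]_(j < N) ((j, q j) \in T).

(** Otherwise [A] lies in a product of [N] sets with at most [D.-1] elements each. *)
Lemma exists_large_projection (N B D : nat) (A : {set {ffun 'I_N -> 'I_B}}) :
  (D.-1 ^ N < #|A|)%N -> exists i, (D <= #|[set (q : {ffun _}) i | q in A]|)%N.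
Proof.
move=> ltA; apply/existsP; apply: contraLR ltA; rewrite negb_exists -leqNgt.
move=> /forallP small; pose F i := [set (q : {ffun 'I_N -> 'I_B}) i | q in A].
have /subset_leq_card/leq_trans-> // : A \subset family F.
  by apply/subsetP=> q qA; apply/familyP=> i; apply: imset_f.
rewrite card_family foldrE big_map big_enum /=.
rewrite -[X in (_ <= _ ^ X)%N]card_ord -prod_nat_const.
apply: leq_prod => i _; have := small i; rewrite -ltnNge => ltD.
by rewrite -ltnS (ltn_predK ltD).
Qed.

(* The queries in [A] take [D] values in some coordinate [i]; fixing their
   answers determines [D] bits of row [i] from the other bits of the table. *)
Lemma xor_query_constant_card (N B D : nat) (A : {set {ffun 'I_N -> 'I_B}})
    (E : {set {set 'I_N * 'I_B}}) :
  (forall q T T', q \in A -> T \in E -> T' \in E -> xor_query T q = xor_query T' q) ->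
  (D.-1 ^ N < #|A|)%N -> (#|E| * 2 ^ D <= 2 ^ (N * B))%N.
Proof.
move=> const /exists_large_projection [i]; set P := [set _ | q in A] => DP.
pose Z := setX [set i] P.
have inj : {in E &, injective (fun T => T :\: Z)}.
  move=> T T' TE T'E /setP eqZ; apply/setP=> -[j c].
  have [/setXP[/set1P -> /imsetP[q qA ->]]|nZ] := boolP ((j, c) \in Z); last first.
    by have := eqZ (j, c); rewrite !in_setD nZ.
  (* The terms of the other digits lie outside [Z], where [T] and [T'] agree; cancelling them leaves
     the bit at [(i, q i)]. *)
  have := const q T T' qA TE T'E; rewrite /xor_query (bigD1 i) // [RHS](bigD1 i) //=.
  rewrite [X in _ (+) X](eq_bigr (fun j => (j, q j) \in T')); first exact: addIb.
  move=> j' j'i; have := eqZ (j', q j').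
  by rewrite !in_setD in_setX in_set1 (negPf j'i).
rewrite -(card_in_imset inj).
have /subset_leq_card : [set T :\: Z | T in E] \subset powerset (~: Z).
  apply/subsetP=> _ /imsetP[T _ ->]; rewrite powersetE; apply/subsetP=> x.
  by rewrite !inE => /andP[].
rewrite card_powerset => cE.
have cZ : (#|P| + #|~: Z| = N * B)%N.
  have -> : #|P| = #|Z| by rewrite cardsX cards1 mul1n.
  by rewrite cardsC card_prod !card_ord.
by rewrite -cZ addnC expnD leq_mul // leq_exp2l.
Qed.

(** * The lower bound with free parameters *)

Definition table (N B : nat) (T : {set 'I_N * 'I_B}) (j c : nat) : bool :=
  (j, c) \in [seq (val x.1, val x.2) | x in T].

Lemma tableE N B (T : {set 'I_N * 'I_B}) j c : table T (val j) (val c) = ((j, c) \in T).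
Proof.
rewrite /table -(@mem_image _ _ (fun x : 'I_N * 'I_B => (val x.1, val x.2))) //.
by move=> [j1 c1] [j2 c2] [/val_inj -> /val_inj ->].
Qed.

Definition position (N B : nat) (q : {ffun 'I_N -> 'I_B}) : nat :=
  (\sum_(j < N) q j * B ^ j)%N.

Lemma nth_padded_xor_string N B n (T : {set 'I_N * 'I_B}) q :
  (position q < B ^ N)%N /\
  nth false (padded_xor_string B N n (table T)) (position q).+1 = xor_query T q.
Proof.
pose q' i := if insub i is Some j then val ((q : {ffun 'I_N -> 'I_B}) j) else 0%N.
have q'E (j : 'I_N) : q' j = q j by rewrite /q' valK.
have [|lt nthE] := @nth_xor_string B (table T) N false q'.
  by move=> i iN; rewrite -[i]/(val (Ordinal iN)) q'E.
have posE : (\sum_(i < N) q' i * B ^ i)%N = position q.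
  by apply: eq_bigr => j _; rewrite q'E.
rewrite posE in lt nthE; split=> //=.
rewrite nth_cat size_xor_string lt nthE /xor_query /=.
by apply: eq_bigr => j _; rewrite q'E tableE.
Qed.

(** If [t] probes always sufficed, the rectangle would hold at least [D ^ N] queries and a fraction
    [2 ^ (- w t)] of the tables, whereas constancy allows only a fraction [2 ^ (- D)], which is
    smaller. *)
Lemma predecessor_probes (n w S t N B D e : nat) (Ds : static_structure n w) :
  answers_predecessor Ds ->
  (0 < B)%N -> (0 < N)%N -> ((B ^ N).+1 < n)%N -> (n < 2 ^ e)%N ->
  (forall U G, in_universe U -> slp_for G (bitstring U) ->
     (gsize G <= 2 * (N * B) + 3 * e + 3)%N -> (size (memory Ds U G) <= S)%N) ->
  (w * t < D)%N -> (D ^ N * S.+1 ^ t <= B ^ N)%N ->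
  exists (U : {set 'I_n.+1}) (G : grammar) (y x : 'I_n.+1),
    [/\ in_universe U, slp_for G (bitstring U), is_predecessor U y x
      & (t < probes (memory Ds U G) (query Ds y))%N].
Proof.
move=> ans B0 N0 BNn ne space wtD DSB.
pose str (T : {set 'I_N * 'I_B}) := padded_xor_string B N n (table T).
pose U T := set_of_string n (str T).
have UE T : bitstring (U T) = str T.
  by rewrite bitstring_set_of_string // size_padded_xor_string // ltnW.
have /fin_all_exists2 [G Gsize GP] T : exists2 G : grammar,
    (gsize G <= 2 * (N * B) + 3 * e + 3)%N & slp_for G (bitstring (U T)).
  by rewrite UE; apply: padded_xor_string_slp.
(* One unit of the shift is for the leading [true], the other because elements count from 1. *)
pose y (q : {ffun 'I_N -> 'I_B}) : 'I_n.+1 := inord (position q).+2.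
have yE q : y q = (position q).+2 :> nat.
  have [lt _] := nth_padded_xor_string n set0 q.
  by rewrite inordK // ltnS (leq_trans _ BNn) // !ltnS ltnW.
have yU T q : (y q \in U T) = xor_query T q.
  have [_ <-] := nth_padded_xor_string n T q; by rewrite inE yE.
have predP T q : exists x, is_predecessor (U T) (y q) x.
  have one : (inord 1 : 'I_n.+1) = 1%N :> nat.
    by rewrite inordK // !ltnS (leq_trans _ BNn).
  by apply: (@predecessor_exists _ _ _ (inord 1)); rewrite ?inE one ?yE.
have [/existsP[T /existsP[q tq]]|few] := boolP [exists T, [exists q,
    (t < probes (memory Ds (U T) (G T)) (query Ds (y q)))%N]].
  have [x xP] := predP T q.
  by exists (U T), (G T), (y q), x; split=> //; exact: in_universe_set_of_string.
have [||A [E [_ _ cA cE const]]] := @probe_rectangle w S t _ _ _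
    (fun T => memory Ds (U T) (G T)) (fun q => query Ds (y q)) setT setT.
- by move=> T; apply: space => //; exact: in_universe_set_of_string.
- move=> q T _ _; rewrite leqNgt; apply: contra few => tq.
  by apply/existsP; exists T; apply/existsP; exists q.
have xor_const q T T' : q \in A -> T \in E -> T' \in E ->
    xor_query T q = xor_query T' q.
  move=> qA TE T'E; have [x xP] := predP T q; have [x' x'P] := predP T' q.
  have inU V := in_universe_set_of_string n (str V).
  have ax := ans (U T) (G T) (y q) x (inU T) (GP T) xP.
  have ax' := ans (U T') (G T') (y q) x' (inU T') (GP T') x'P.
  rewrite -!yU -(predecessor_self xP) -(predecessor_self x'P).
  by rewrite -ax -ax' (const q T T').
have : (#|E| * 2 ^ D <= 2 ^ (N * B))%N.
  apply: (xor_query_constant_card xor_const).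
  rewrite -(ltn_pmul2r (m := S.+1 ^ t)) ?expn_gt0 //.
  apply: leq_trans cA; rewrite cardsT card_ffun !card_ord.
  apply: leq_trans DSB; rewrite ltn_pmul2r ?expn_gt0 // ltn_exp2r //.
  by rewrite prednK //; apply: leq_ltn_trans wtD.
rewrite leqNgt => /negP[]; move: cE.
rewrite -powersetT card_powerset cardsT card_prod !card_ord => cE.
apply: (leq_ltn_trans cE); rewrite ltn_mul2l ltn_exp2l // wtD andbT.
(* The strict comparison needs [E] nonempty, which its share of the tables ensures. *)
by rewrite lt0n; apply/eqP=> E0; move: cE; rewrite E0 leqNgt expn_gt0.
Qed.

(** * Logarithm estimates and choice of parameters *)

(** Both bounds come from [1 / 2 <= ln 2 <= 1], which is [ln (1 + x) <= x] at [x = - 1 / 2] and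
    [x = 1]. *)
Lemma ln_pow2_bounds (R : realType) (n m : nat) : (2 ^ m <= n < 2 ^ m.+1)%N ->
  m%:R / 2 <= ln (n%:R : R) <= m%:R + 1.
Proof.
move=> /andP[len ltn].
have n0 : (0 < n)%N by rewrite (leq_trans _ len) // expn_gt0.
have ln2_le : ln (2 : R) <= 1.
  by have := @le_ln1Dx R 1; rewrite (_ : 1 + 1 = 2) //; apply; lra.
have ln2_ge : 1 / 2 <= ln (2 : R).
  have := @le_ln1Dx R (- (1 / 2)); rewrite (_ : 1 + - (1 / 2) = 2^-1); last by lra.
  by rewrite lnV ?posrE //; lra.
have lnE i : ln ((2 ^ i)%:R : R) = i%:R * ln 2.
  by rewrite natrX lnXn // mulr_natl.
have lo : ln ((2 ^ m)%:R : R) <= ln n%:R.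
  by rewrite ler_ln ?posrE ?ltr0n ?expn_gt0 // ler_nat.
have hi : ln (n%:R : R) <= ln (2 ^ m.+1)%:R.
  by rewrite ler_ln ?posrE ?ltr0n ?expn_gt0 // ler_nat ltnW.
rewrite !lnE in lo hi; have m0 : 0 <= m%:R :> R by [].
rewrite -natr1 in hi.
by apply/andP; split; nra.
Qed.

Lemma ln_ge_pow2 (R : realType) (x : R) (m : nat) : 2 ^+ m <= x -> m%:R / 2 <= ln x.
Proof.
move=> mx; have := @ln_pow2_bounds R (2 ^ m) m.
rewrite leqnn ltn_exp2l // ltnSn => /(_ isT) /andP[+ _]; rewrite natrX => /le_trans-> //.
by rewrite ler_ln ?posrE ?exprn_gt0 // (lt_le_trans _ mx) ?exprn_gt0.
Qed.

Lemma slp_size_pow6 (x m N : nat) : (32 <= x)%N -> (m < 2 * x)%N -> (N <= m)%N ->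
  (2 * (N * x ^ 4) + 3 * m.+1 + 3 <= x ^ 6)%N.
Proof.
move=> x32 mx Nm; have x5 : (x <= x ^ 5)%N by rewrite -{1}[x]expn1 leq_pexp2l //; lia.
have NB : (N * x ^ 4 <= 2 * x ^ 5)%N.
  by rewrite (expnS x 4) mulnA leq_mul2r (leq_trans Nm (ltnW mx)) orbT.
have x6 : (32 * x ^ 5 <= x ^ 6)%N by rewrite (expnS x 5) leq_mul2r x32 orbT.
by lia.
Qed.

Theorem theorem7 (R : realType) (C W : R) (k : nat) :
  exists (delta : R) (n0 : nat), 0 < delta /\
    forall (n w : nat) (D : static_structure n w),
      (n0 <= n)%N ->
      w%:R <= W * ln (n%:R : R) ->
      answers_predecessor D ->
      uses_space D (fun G => C * (gsize G)%:R * ln (n%:R : R) ^+ k) ->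
      exists (U : {set 'I_n.+1}) (G : grammar) (y x : 'I_n.+1),
        [/\ in_universe U, slp_for G (bitstring U), is_predecessor U y x &
          delta * (ln (n%:R : R) / ln (ln (n%:R : R)))
            <= (probes (memory D U G) (query D y))%:R].
Proof.
(* With [x = 2 ^ lam] below, the memory has at most [x ^ (7 + 2 * k)] cells: [x] for [C], [x ^ 6]
   for the grammar, [x ^ (2 * k)] for the logarithms. One more factor absorbs the successor in
   [S.+1]. *)
pose e := (8 + 2 * k)%N.
(* The 5 gives [4 * lam < x] and [32 <= x]; the other terms put [C] and [4 * W] below [x]. *)
pose lam0 := maxn 5 (maxn (Num.bound C) (Num.bound (4 * W))).
have e0 : 0 < e%:R :> R by rewrite ltr0n.
exists (1 / (32 * e%:R)), (2 ^ (2 ^ lam0))%N; split; first by apply: divr_gt0; lra.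
move=> n w D n0n wW ans space.
pose m := trunc_log 2 n; pose lam := trunc_log 2 m; pose x := (2 ^ lam)%N.
have n_gt0 : (0 < n)%N by rewrite (leq_trans _ n0n) // expn_gt0.
have le_m : (2 ^ lam0 <= m)%N by apply: trunc_log_max.
have m_gt0 : (0 < m)%N by rewrite (leq_trans _ le_m) // expn_gt0.
have le_lam : (lam0 <= lam)%N by apply: trunc_log_max.
have mx : (x <= m < 2 * x)%N by rewrite -expnS trunc_logP //= trunc_log_ltn.
have nm : (2 ^ m <= n < 2 ^ m.+1)%N by rewrite trunc_logP //= trunc_log_ltn.
move: le_lam; rewrite !geq_max => /and3P[lam5 lamC lamW].
have Cx : C < x%:R by rewrite natrX; apply: upper_nthrootP.
have Wx : 4 * W < x%:R by rewrite natrX; apply: upper_nthrootP.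
have x_gt : (4 * lam < x)%N.
  rewrite /x; elim: (lam) lam5 => // i IH; rewrite leq_eqVlt => /orP[/eqP<- //|i5].
  by have := IH i5; rewrite expnS; lia.
have x32 : (32 <= x)%N by rewrite -[32%N]/(2 ^ 5)%N leq_exp2l.
have /andP[L_ge L_le] := ln_pow2_bounds R nm; set L := ln (n%:R : R) in wW space L_ge L_le *.
(* Here [B = x ^ 4] and [D = x ^ 3], so [D ^ N * S.+1 ^ t <= B ^ N] follows from [t * e <= N]. Using
   [m.-1] makes [B ^ N] at most [2 ^ m.-1], which leaves room for the padding. *)
pose B := (2 ^ (4 * lam))%N; pose N := (m.-1 %/ (4 * lam))%N; pose t := (N %/ e)%N.
have lam_gt0 : (0 < 4 * lam)%N by rewrite muln_gt0 (leq_trans _ lam5).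
have N_gt0 : (0 < N)%N by rewrite divn_gt0 // -ltnS prednK // (leq_trans x_gt) //;
  case/andP: mx.
have N_le : (N * (4 * lam) <= m.-1)%N by apply: leq_trunc_div.
have Nm : (N <= m)%N.
  by apply: leq_trans (leq_pmulr N lam_gt0) (leq_trans N_le (leq_pred m)).
have BNn : ((B ^ N).+1 < n)%N.
  apply: (@leq_trans (2 ^ m)); last by case/andP: nm.
  have BN : (B ^ N <= 2 ^ m.-1)%N by rewrite /B -expnM leq_exp2l // mulnC.
  have m1 : (1 < m)%N by case/andP: mx => /(leq_trans x32) /(leq_trans _)->.
  rewrite -(prednK m_gt0) expnS mul2n -addnn -addn2 leq_add //.
  by rewrite -[2%N]/(2 ^ 1)%N leq_exp2l // -ltnS prednK.
have L_le2x : L <= 2 * x%:R.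
  apply: le_trans L_le _; rewrite natr1 -natrM ler_nat; by case/andP: mx.
have L_ge0 : 0 <= L by apply: le_trans L_ge; rewrite divr_ge0.
have space' U G : in_universe U -> slp_for G (bitstring U) ->
    (gsize G <= 2 * (N * B) + 3 * m.+1 + 3)%N ->
    (size (memory D U G) <= 2 ^ ((7 + 2 * k) * lam))%N.
  move=> inU GU sG; rewrite -(ler_nat R); apply: le_trans (space U G inU GU) _.
  have gx : (gsize G <= x ^ 6)%N.
    apply: leq_trans sG _; rewrite (_ : B = x ^ 4)%N; last by rewrite /B mulnC expnM.
    by apply: slp_size_pow6; [exact: x32 | case/andP: mx | exact: Nm].
  have x_ge0 : 0 <= x%:R :> R by [].
  have Lx : L <= x%:R ^+ 2.
    have : 32 <= x%:R :> R by rewrite (ler_nat R 32).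
    by rewrite expr2; nra.
  apply: (@le_trans _ _ (x%:R * (gsize G)%:R * L ^+ k)).
    by rewrite !ler_wpM2r ?exprn_ge0 // ltW.
  rewrite natrX mulnC exprM -natrX -/x exprD (exprM _ 2) (exprS _ 6).
  rewrite ler_pM ?mulr_ge0 ?exprn_ge0 //; last by rewrite lerXn2r ?nnegrE ?exprn_ge0.
  by rewrite ler_wpM2l // -natrX ler_nat.
have tN : (t * e <= N)%N by apply: leq_trunc_div.
(* Since [4 * W < x] and [L <= 2 * x], a word has at most [x ^ 2 / 2] bits, while [t < 2 * x]. *)
have wtD : (w * t < 2 ^ (3 * lam))%N.
  have w2 : (2 * w <= x ^ 2)%N.
    rewrite -(ler_nat R) natrM natrX expr2; have := ltW Wx; move: wW L_le2x L_ge0.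
    by clear; set X := x%:R; nra.
  have t2 : (t < 2 * x)%N.
    rewrite (leq_ltn_trans (leq_div N e)) // (leq_ltn_trans Nm) //.
    by case/andP: mx.
  rewrite mulnC expnM [X in (_ < X)%N]expnAC -/x (expnS x 2).
  have x2 : (0 < x ^ 2)%N by rewrite expn_gt0 (leq_trans _ x32).
  by move: w2 t2 x2; clear; generalize (x ^ 2)%N; nia.
have DSB : ((2 ^ (3 * lam)) ^ N * (2 ^ ((7 + 2 * k) * lam)).+1 ^ t <= B ^ N)%N.
  apply: (@leq_trans ((2 ^ (3 * lam)) ^ N * (2 ^ (e * lam)) ^ t)).
    rewrite leq_mul2l; apply/orP; right; case: (t) => // t'.
    by rewrite leq_exp2r // ltn_exp2l // ltn_mul2r ltnSn andbT (leq_trans _ lam5).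
  rewrite /B -!expnM -expnD leq_exp2l // [(4 * lam)%N]mulSn mulnDl addnC leq_add2r.
  by rewrite mulnAC mulnC leq_mul2l mulnC tN orbT.
have B_gt0 : (0 < B)%N by rewrite expn_gt0.
have [U [G [y [z [inU GU yz tz]]]]] :=
  predecessor_probes ans B_gt0 N_gt0 BNn (proj2 (andP nm)) space' wtD DSB.
exists U, G, y, z; split=> //; set P := probes _ _ in tz *.
(* From [t < P], undo the two rounded divisions that define [t] and [N]. *)
have mP : (m <= P * e * (4 * lam))%N.
  rewrite -(prednK m_gt0); apply: leq_trans (ltn_ceil m.-1 lam_gt0) _.
  rewrite leq_mul2r; apply/orP; right; apply: leq_trans (@ltn_ceil N e isT) _.
  by rewrite leq_mul2r tz orbT.
have lnL : lam%:R / 4 <= ln L.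
  have le_L : 2 ^+ lam.-1 <= L.
    apply: le_trans L_ge; rewrite ler_pdivlMr // -exprSr prednK ?(leq_trans _ lam5) //.
    by rewrite -natrX ler_nat; case/andP: mx.
  apply: le_trans (ln_ge_pow2 le_L); rewrite -[in X in X <= _](@prednK lam); last first.
    by rewrite (leq_trans _ lam5).
  have : 1 <= lam.-1%:R :> R by rewrite (ler_nat R 1) -ltnS prednK (leq_trans _ lam5).
  by rewrite -natr1; clear; lra.
have lam1 : 0 < lam%:R :> R by rewrite ltr0n (leq_trans _ lam5).
have lnL_gt0 : 0 < ln L by apply: lt_le_trans lnL; apply: divr_gt0.
rewrite mulrA ler_pdivrMr // mul1r mulrC ler_pdivrMr ?mulr_gt0 //.
have mR : m%:R <= P%:R * e%:R * (4 * lam%:R) :> R by rewrite -!natrM ler_nat.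
have m1 : 1 <= m%:R :> R by rewrite (ler_nat R 1).
have Pe : 0 <= P%:R * e%:R :> R by rewrite -natrM.
have := ler_wpM2l Pe lnL.
(* The constant 32 arises here: [lam <= 4 * ln L] gives [m <= 16 * P * e * ln L], and
   [L <= m + 1 <= 2 * m]. *)
move: L_le mR m1; clear; nra.
Qed.
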